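(* Let $n\in\mathbb{N}$, $n\ge 1$. For $i=1,\ldots,n$ let $\mathbb{H}_i$ be a complex Hilbert space and let $T_i$ be a contraction on $\mathbb{H}_i$ such that $\mathbb{T}\subseteq\sigma(T_i)$. For $i=1,\ldots,n$ define the operator on $\mathbb{H}_1\otimes\cdots\otimes\mathbb{H}_n$ $$\tilde{T}_i = I_{\mathbb{H}_1}\otimes\cdots\otimes I_{\mathbb{H}_{i-1}}\otimes T_i\otimes I_{\mathbb{H}_{i+1}}\otimes\cdots\otimes I_{\mathbb{H}_n}.$$ Then the function $f_{\boldsymbol{T}}:\ell^1(n)\to\mathcal{B}(\mathbb{H}_1\otimes\cdots\otimes\mathbb{H}_n)$ defined by $$f_{\boldsymbol{T}}(a_1,\ldots,a_n)=a_1\tilde{T}_1+\cdots+a_n\tilde{T}_n$$ is an isometry.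
   Context: $\ell^1(n)$ denotes $\mathbb{C}^n$ with the norm $\|(a_1,\ldots,a_n)\|_1=\sum_{i=1}^n|a_i|$. $\mathbb{T}$ is the unit circle in $\mathbb{C}$; $\sigma(T)$ is the spectrum of a bounded operator $T$; a contraction is a bounded linear operator of norm at most $1$. $\mathcal{B}(\mathbb{H})$ is the space of bounded operators on $\mathbb{H}$ with the operator norm, and $\otimes$ denotes the Hilbert space tensor product (and the corresponding tensor product of bounded operators). *)

(* Defs.v *)
From HB Require Import structures.
From mathcomp Require Import all_boot all_order all_algebra.
From mathcomp Require Import sesquilinear complex.
From mathcomp Require Import boolp classical_sets functions reals topology.
From mathcomp Require Import normedtype.

Set Implicit Arguments.
Unset Strict Implicit.
Unset Printing Implicit Defensive.

Import Order.TTheory GRing.Theory Num.Theory.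
Import numFieldNormedType.Exports.

Local Open Scope classical_set_scope.
Local Open Scope ring_scope.
Local Open Scope complex_scope.

(* [inner] is linear in its first argument and conjugate-linear in its second
   one (the convention of {dot _ for _}). *)
HB.mixin Record CompleteNormedModule_isHilbert (R : realType) V
    of CompleteNormedModule R[i] V := {
  inner : {dot V for (@Num.conj R[i])};
  sqr_norm_inner : forall x : V, `|x| ^+ 2 = inner x x
}.

#[short(type="hilbertType")]
HB.structure Definition Hilbert (R : realType) :=
  {V of CompleteNormedModule R[i] V & CompleteNormedModule_isHilbert R V}.

Section RealNorm.
Variables (R : realType) (V : normedModType R[i]).
Implicit Types x y : V.

(* In a normedModType over R[i], `|x| is an element of R[i]; [rnorm x] is the
   same nonnegative number, seen in R. *)
Definition rnorm x : R := complex.Re `|x|.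

Lemma rnormE x : (rnorm x)%:C = `|x|.
Proof. by rewrite /rnorm RRe_real// normr_real. Qed.

Lemma rnorm0 : rnorm 0 = 0.
Proof. by rewrite /rnorm normr0. Qed.

Lemma rnorm_ge0 x : 0 <= rnorm x.
Proof. by rewrite -ler0c rnormE. Qed.

Lemma rnormD x y : rnorm (x + y) <= rnorm x + rnorm y.
Proof. by rewrite -lecR rmorphD/= !rnormE ler_normD. Qed.

Lemma rnormZ (a : R[i]) x : rnorm (a *: x) = complex.Re `|a| * rnorm x.
Proof.
have Cinj : injective (real_complex R) by move=> u v [].
by apply: Cinj; rewrite rmorphM/= !rnormE normrZ.
Qed.

End RealNorm.

Section BoundedOperators.
Variables (R : realType) (H : hilbertType R).

Definition bounded_operator : {pred H -> H} := fun A =>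
  `[< linear A /\ exists M : R, forall x, rnorm (A x) <= M * rnorm x >].

Record bop := Bop { bop_fun :> H -> H; _ : bop_fun \in bounded_operator }.

HB.instance Definition _ := [isSub for bop_fun].
HB.instance Definition _ := [Choice of bop by <:].

Lemma bounded_operatorP (A : H -> H) :
  reflect (linear A /\ exists M : R, forall x, rnorm (A x) <= M * rnorm x)
          (A \in bounded_operator).
Proof. exact: asboolP. Qed.

Fact bounded_operator_submod : submod_closed bounded_operator.
Proof.
split.
  apply/bounded_operatorP; split.
    by move=> a x y; rewrite /GRing.zero /= scaler0 addr0.
  by exists 0 => x; rewrite [X in rnorm X]/GRing.zero /= rnorm0 mul0r.
move=> a A B /bounded_operatorP[linA [M AM]] /bounded_operatorP[linB [N BN]].
have E x : (a *: A + B) x = a *: A x + B x by [].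
apply/bounded_operatorP; split.
  move=> b x y; rewrite !E linA linB !scalerDr !scalerA [a * b]mulrC.
  by rewrite -!addrA; congr (_ + _); rewrite addrCA.
exists (complex.Re `|a| * M + N) => x; rewrite E.
rewrite (le_trans (rnormD _ _))// mulrDl lerD// rnormZ -mulrA.
by rewrite ler_wpM2l// -ler0c RRe_real// normr_real.
Qed.

HB.instance Definition _ :=
  GRing.isSubmodClosed.Build R[i] (H -> H) bounded_operator
    bounded_operator_submod.
HB.instance Definition _ := [SubChoice_isSubLmodule of bop by <:].

Fact bop_id_subproof : idfun \in bounded_operator.
Proof.
by apply/bounded_operatorP; split=> //; exists 1 => x; rewrite mul1r.
Qed.

Definition bop_id : bop := Bop bop_id_subproof.

Definition opnorm (A : bop) : R :=
  sup [set rnorm (A x) | x in [set x | rnorm x <= 1]].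

Definition bop_invertible (A : bop) : Prop :=
  exists B : bop, cancel A B /\ cancel B A.

Definition spectrum (A : bop) : set R[i] :=
  [set z | ~ bop_invertible (A - z *: bop_id)].

Definition bop_contraction (A : bop) : Prop := opnorm A <= 1.

End BoundedOperators.

(* A Hilbert space tensor product of the H_i: a Hilbert space in which the
   algebraic tensor product, with the inner product
   <x_1 (x) ... (x) x_n, y_1 (x) ... (x) y_n> = prod_i <x_i, y_i>,
   embeds as a dense subspace.  This determines it up to a unique unitary map
   compatible with [tens]. *)
Record hilbert_tensor (R : realType) (n : nat) (H : 'I_n -> hilbertType R) :=
  HilbertTensor {
    tensor_space :> hilbertType R;
    tens : (forall i, H i) -> tensor_space;
    tens_linear : forall (x : forall i, H i) (i : 'I_n),
      linear (fun u : H i => tens (dfwith x u));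
    inner_tens : forall x y : forall i, H i,
      inner (tens x) (tens y) = \prod_(i < n) inner (x i) (y i);
    tens_dense : dense [set v | exists (m : nat) (c : 'I_m -> R[i])
      (x : 'I_m -> forall i, H i), v = \sum_(k < m) c k *: tens (x k)]
  }.

Section TensorOperators.
Variables (R : realType) (n : nat) (H : 'I_n -> hilbertType R).
Variable K : hilbert_tensor H.

(* A_1 (x) ... (x) A_n is the bounded operator on K prescribed on elementary
   tensors by the set below.  Such an operator exists, and it is unique because
   elementary tensors span a dense subspace; the default value 0 of [xget]
   plays no role. *)
Definition tensor_op (A : forall i, bop (H i)) : bop K :=
  xget 0 [set B : bop K |
    forall x, B (tens K x) = tens K (fun i => A i (x i))].

(* Id (x) ... (x) Id (x) A (x) Id (x) ... (x) Id, with A in position i. *)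
Definition ampliation (i : 'I_n) (A : bop (H i)) : bop K :=
  tensor_op (dfwith (fun j => bop_id (H j)) A).

End TensorOperators.

(* The norm of l^1(n).  The canonical norm of 'rV_n in the library is the
   maximum norm, hence this separate definition. *)
Definition l1norm (R : realType) (n : nat) (a : 'rV[R[i]]_n) : R :=
  \sum_(i < n) complex.Re `|a 0 i|.

Definition l1_isometry (R : realType) (n : nat) (K : hilbertType R)
    (f : 'rV[R[i]]_n -> bop K) : Prop :=
  forall a b, opnorm (f a - f b) = l1norm (a - b).

(* Main.v *)
From HB Require Import structures.
Require Import Defs.
From mathcomp Require Import all_boot all_order all_algebra.
From mathcomp Require Import sesquilinear spectral complex.
From mathcomp Require Import boolp classical_sets functions reals topology.
From mathcomp Require Import normedtype.

(** Write T~_i for the ampliation of T_i.  Since T_1~, ..., T_n~ are combined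
    linearly, it is enough to show that the operator norm of
    sum_i c_i T~_i is sum_i |c_i| for all scalars c_i
    ([opnorm_sum_ampliation]).

    Upper bound.  By the triangle inequality it suffices that T~_i exists as a
    bounded operator and is a contraction ([ampliationP]).  On the span of the
    elementary tensors this is the inequality
    |sum_k c_k tens x_k'| <= |sum_k c_k tens x_k|, where x_k' is x_k with its
    i-th entry replaced by its image under T_i ([rnorm_ampliation_le]).  The
    difference of the squared norms is a sum over k, l of the product of two
    positive semidefinite kernels, namely a Gram kernel coming from the factors
    other than the i-th and the defect <u_k, u_l> - <T_i u_k, T_i u_l> of the
    contraction T_i, so the Schur product theorem ([schur_psd]) shows that it is
    nonnegative.  The inequality makes the prescription on elementary tensors
    well defined, and it then extends to the whole space by density and
    completeness ([bounded_relation_extends]).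

    Lower bound.  A point z of the unit circle in the spectrum of a contraction
    T is an approximate eigenvalue ([approximate_eigenvector]).  Otherwise
    1 - U is bounded below, where U = T / z is again a contraction; but the
    ergodic averages of U satisfy |(1 - U) A_N y| <= 2 |y| / N, so that A_N y
    tends to 0, while y - A_N y lies in the range of 1 - U.  Hence 1 - U has
    dense range, and being bounded below it is invertible.  Now choose z_i of
    modulus 1 with c_i z_i = |c_i| and unit vectors w_i such that T_i w_i is
    close to z_i w_i.  The elementary tensor w of the w_i is a unit vector which
    sum_i c_i T~_i maps close to (sum_i |c_i|) w. *)

Import Order.TTheory GRing.Theory Num.Theory.
Import numFieldNormedType.Exports.

Local Open Scope classical_set_scope.
Local Open Scope ring_scope.
Local Open Scope complex_scope.

(** * The real-valued norm *)

Section RealNormTheory.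
Context {R : realType} {V : normedModType R[i]}.
Implicit Types x y : V.

Lemma rnormN x : rnorm (- x) = rnorm x.
Proof. by rewrite /rnorm normrN. Qed.

Lemma rnormB x y : rnorm (x - y) = rnorm (y - x).
Proof. by rewrite -opprB rnormN. Qed.

Lemma ler_rnormB x y : rnorm (x - y) <= rnorm x + rnorm y.
Proof. by rewrite -(rnormN y) rnormD. Qed.

Lemma rnorm_dist z x y : rnorm (x - y) <= rnorm (x - z) + rnorm (z - y).
Proof. by rewrite -[x - y](subrKA z) rnormD. Qed.

Lemma rnorm_eq0 x : rnorm x = 0 -> x = 0.
Proof. by move=> x0; apply: normr0_eq0; rewrite -rnormE x0. Qed.

Lemma rnorm_sum I (r : seq I) (F : I -> V) :
  rnorm (\sum_(i <- r) F i) <= \sum_(i <- r) rnorm (F i).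
Proof.
elim: r => [|i r IH]; first by rewrite !big_nil rnorm0.
by rewrite !big_cons (le_trans (rnormD _ _))// lerD2l.
Qed.

Lemma ball_rnorm x y (e : R) : ball x (e%:C) y <-> rnorm (x - y) < e.
Proof. by rewrite -ball_normE /= -rnormE ltcR. Qed.

Lemma complex_gt0P (e : R[i]) : 0 < e -> exists2 d : R, 0 < d & e = d%:C.
Proof.
by case: e => a b; rewrite ltcE /= => /andP[/eqP-> a0]; exists a.
Qed.

Lemma dense_rnorm (S : set V) y (e : R) : dense S -> 0 < e ->
  exists2 v, S v & rnorm (v - y) < e.
Proof.
move=> dS e0; have e0C : 0 < e%:C :> R[i] by rewrite ltcR.
have [||v [yv Sv]] := dS (ball y e%:C).
- by exists y; apply: ballxx.
- exact: ball_open.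
- by exists v => //; rewrite rnormB; apply/ball_rnorm.
Qed.

End RealNormTheory.

Lemma re_norm_real {R : realType} (r : R) : complex.Re `|r%:C| = `|r|.
Proof. by rewrite normc_def /= expr0n /= addr0 sqrtr_sqr. Qed.

Lemma re_normc_ge0 {R : realType} (z : R[i]) : 0 <= complex.Re `|z|.
Proof. by rewrite -ler0c RRe_real ?normr_real. Qed.

(** * Completeness in terms of the real norm *)

Lemma harmonic_lt {R : realType} (C e : R) : 0 < e ->
  \forall n \near \oo, C / n.+1%:R < e.
Proof.
move=> e0; have := archi_boundP (normr_ge0 (C / e)).
set N := Num.Def.archi_bound _ => ltN; exists N => // n /= leNn.
rewrite ltr_pdivrMr ?ltr0n// -ltr_pdivrMl// mulrC.
apply: le_lt_trans (ler_norm _) (lt_trans ltN _).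
by rewrite ltr_nat.
Qed.

(** Prescribing the rate 1 / n keeps the rate for the limit, so that later
    arguments need only one index instead of an epsilon and a threshold. *)
Lemma harmonic_cauchy_limit {R : realType} {V : completeNormedModType R[i]}
    (C : R) (u : nat -> V) :
  (forall m n, rnorm (u m - u n) <= C / m.+1%:R + C / n.+1%:R) ->
  exists l, forall n, rnorm (u n - l) <= C / n.+1%:R.
Proof.
move=> uC; have /cvgrPdist_lt ul : cvgn u.
  apply/cauchy_cvgP; apply: cauchy_exP => e /complex_gt0P[d d0 ->].
  have d20 : 0 < d / 2 by rewrite divr_gt0.
  have [N _ CN] := harmonic_lt C _ d20.
  exists (u N), N => // n /= leNn; apply/ball_rnorm.
  rewrite (le_lt_trans (uC N n))// [d]splitr ltrD//; apply: CN => //=.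
exists (limn u) => n; apply/ler_addgt0Pr => e e0.
have e20 : 0 < e / 2 by rewrite divr_gt0.
have e2C : 0 < (e / 2)%:C :> R[i] by rewrite ltcR.
have [m [Cm um]] :
    exists m, C / m.+1%:R < e / 2 /\ rnorm (limn u - u m) < e / 2.
  have [M _ CM] := harmonic_lt C _ e20; have [N _ uN] := ul _ e2C.
  exists (maxn M N); split; first by apply: CM => /=; rewrite leq_maxl.
  by rewrite -ltcR rnormE; apply: uN => /=; rewrite leq_maxr.
rewrite (le_trans (rnorm_dist (u m) _ _))// [e]splitr addrA.
rewrite lerD//; last by rewrite rnormB ltW.
by rewrite (le_trans (uC n m))// lerD2l ltW.
Qed.

(** * Bounded operators *)

Section BoundedOperatorTheory.
Context {R : realType} {H : hilbertType R}.
Implicit Types A B : bop H.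

Fact bop_is_linear A : linear A.
Proof. by case: A => f /= /bounded_operatorP[]. Qed.

HB.instance Definition _ A :=
  GRing.isLinear.Build R[i] H H _ (bop_fun A) (bop_is_linear A).

Lemma bop_lincomb A m (c : 'I_m -> R[i]) (x : 'I_m -> H) :
  A (\sum_k c k *: x k) = \sum_k c k *: A (x k).
Proof. by rewrite (raddf_sum A); apply: eq_bigr => k _; exact: linearZ_LR. Qed.

Lemma bop_bounded A :
  exists2 M : R, 0 <= M & forall x, rnorm (A x) <= M * rnorm x.
Proof.
case: A => f /= /bounded_operatorP[_ [M fM]]; exists `|M| => // x.
by rewrite (le_trans (fM x))// ler_wpM2r ?rnorm_ge0 ?ler_norm.
Qed.

Lemma bop_sumE I (r : seq I) (F : I -> bop H) x :
  (\sum_(i <- r) F i) x = \sum_(i <- r) F i x.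
Proof. by elim/big_rec2: _ => // i y B _ <-. Qed.

Lemma le_opnorm A x : rnorm (A x) <= opnorm A * rnorm x.
Proof.
have [M M0 AM] := bop_bounded A.
have Asup y : rnorm y <= 1 -> rnorm (A y) <= opnorm A.
  move=> y1; apply: ub_le_sup; last by exists y.
  exists M => _ [z /= z1 <-]; rewrite (le_trans (AM z))//.
  by rewrite -[leRHS]mulr1 ler_wpM2l.
have [/rnorm_eq0->|x0] := eqVneq (rnorm x) 0.
  by rewrite linear0 !rnorm0 mulr0.
have xgt0 : 0 < rnorm x by rewrite lt_def x0 rnorm_ge0.
have invE : complex.Re `|((rnorm x)^-1)%:C : R[i]| = (rnorm x)^-1.
  by rewrite ger0_norm//= ler0c invr_ge0 ltW.
have := Asup (((rnorm x)^-1)%:C *: x).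
rewrite linearZ !rnormZ invE mulVf// => /(_ (lexx _)).
by rewrite mulrC ler_pdivrMr.
Qed.

Lemma opnorm_le A (C : R) :
  (forall x, rnorm (A x) <= C * rnorm x) -> 0 <= C -> opnorm A <= C.
Proof.
move=> AC C0; apply: ge_sup.
  by exists (rnorm (A 0)), 0 => //=; rewrite rnorm0.
move=> _ [x /= x1 <-]; rewrite (le_trans (AC x))//.
by rewrite -[leRHS]mulr1 ler_wpM2l.
Qed.

Lemma bop_eq_dense A B (D : set H) :
  (forall y (e : R), 0 < e -> exists2 v, D v & rnorm (v - y) < e) ->
  (forall v, D v -> A v = B v) -> A =1 B.
Proof.
move=> dD AB y; apply/eqP; rewrite -subr_eq0; apply/eqP/rnorm_eq0/le_anti.
rewrite rnorm_ge0 andbT; have [M M0 AM] := bop_bounded (A - B).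
apply/ler_addgt0Pr => e e0; rewrite add0r.
have M1 : 0 < M + 1 by rewrite ltr_wpDl.
have [v Dv vy] := dD y _ (divr_gt0 e0 M1).
have -> : A y - B y = (A - B) (y - v).
  rewrite (linearB (A - B)) -[RHS]/((A y - B y) - (A v - B v)).
  by rewrite (AB v Dv) subrr subr0.
rewrite (le_trans (AM _))//.
have := ltW vy; rewrite ler_pdivlMr// rnormB => /(le_trans _); apply.
by rewrite mulrC ler_wpM2l ?rnorm_ge0// lerDl.
Qed.

(** [G b a] is a graph on which the value [a] is controlled by the argument [b];
    a relation is used because an argument may have many presentations, whose
    values agree only thanks to the bound.  The closure [cl] of the graph is
    single valued by the bound and total by density and completeness.  It serves
    both to construct tensor products of operators and to invert operators. *)
Lemma bounded_relation_extends (G : H -> H -> Prop) (C : R) : 0 <= C ->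
  (forall k b a b' a', G b a -> G b' a' -> G (k *: b + b') (k *: a + a')) ->
  (forall b a, G b a -> rnorm a <= C * rnorm b) ->
  (forall y (e : R), 0 < e -> exists b a, G b a /\ rnorm (b - y) < e) ->
  exists B : bop H, (forall b a, G b a -> B b = a) /\
    (forall y, rnorm (B y) <= C * rnorm y).
Proof.
move=> C0 Glin Gbnd Gdense.
pose cl y x := forall e : R, 0 < e ->
  exists b a, [/\ G b a, rnorm (b - y) < e & rnorm (a - x) < e].
have clG b a : G b a -> cl b a.
  by move=> Gba e e0; exists b, a; rewrite !subrr !rnorm0.
have cllin k y x y' x' : cl y x -> cl y' x' -> cl (k *: y + y') (k *: x + x').
  move=> yx yx' e e0; pose K := complex.Re `|k| + 1.
  have K0 : 0 < K by rewrite ltr_wpDl ?re_normc_ge0.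
  have e2 : 0 < e / 2 by rewrite divr_gt0.
  have [b [a [Gba by_ ax]]] := yx _ (divr_gt0 e2 K0).
  have [b' [a' [Gba' by' ax']]] := yx' _ e2.
  have small (u v u' v' : H) : rnorm (u - v) < e / 2 / K ->
      rnorm (u' - v') < e / 2 ->
      rnorm (k *: u + u' - (k *: v + v')) < e.
    move=> uv uv'; rewrite opprD addrACA -scalerBr [e]splitr.
    rewrite (le_lt_trans (rnormD _ _))// ltr_leD//; last exact: ltW.
    rewrite rnormZ; move: uv; rewrite ltr_pdivlMr//; apply: le_lt_trans.
    by rewrite mulrC ler_wpM2l ?rnorm_ge0// lerDl.
  by exists (k *: b + b'), (k *: a + a'); split; [exact: Glin|exact: small..].
have clbnd y x : cl y x -> rnorm x <= C * rnorm y.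
  move=> yx; apply/ler_addgt0Pr => e e0.
  have C1 : 0 < C + 1 by rewrite ltr_wpDl.
  have [b [a [Gba by_ ax]]] := yx _ (divr_gt0 e0 C1).
  rewrite -[x]subr0 (le_trans (rnorm_dist a _ _))// subr0 rnormB.
  rewrite (le_trans (lerD (ltW ax) (Gbnd _ _ Gba)))//.
  have byn : rnorm b <= e / (C + 1) + rnorm y.
    by rewrite -[b]subr0 (le_trans (rnorm_dist y _ _))// subr0 lerD2r ltW.
  rewrite (le_trans (lerD (lexx _) (ler_wpM2l C0 byn)))//.
  rewrite mulrDr addrA addrC lerD2l -[X in X + _]mul1r -mulrDl addrC.
  by rewrite mulrC divfK ?gt_eqF.
have clfun y x x' : cl y x -> cl y x' -> x = x'.
  move=> yx yx'; apply/eqP; rewrite -subr_eq0; apply/eqP/rnorm_eq0/le_anti.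
  rewrite rnorm_ge0 andbT; have := clbnd _ _ (cllin (-1) _ _ _ _ yx' yx).
  by rewrite !scaleN1r addNr rnorm0 mulr0 addrC.
have cltot y : exists x, cl y x.
  have Gn n : exists ba : H * H, G ba.1 ba.2 /\ rnorm (ba.1 - y) < n.+1%:R^-1.
    have [|b [a Gba]] := Gdense y n.+1%:R^-1; first by rewrite invr_gt0 ltr0n.
    by exists (b, a).
  have [ba baP] := choice Gn.
  have [m n|x xP] := harmonic_cauchy_limit C (fun n => (ba n).2).
    have := Gbnd _ _ (Glin (-1) _ _ _ _ (baP n).1 (baP m).1).
    rewrite !scaleN1r ![- _ + _]addrC => /le_trans; apply.
    rewrite -mulrDr ler_wpM2l// (le_trans (rnorm_dist y _ _))//.
    rewrite lerD// 1?[rnorm (y - _)]rnormB ltW//; last exact: (baP n).2.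
    exact: (baP m).2.
  exists x => e e0.
  have [N _ N1] := harmonic_lt 1 _ e0; have [M _ MC] := harmonic_lt C _ e0.
  pose k := maxn N M; exists (ba k).1, (ba k).2.
  have [Gk yk] := baP k; split => //.
    by apply: lt_trans yk _; rewrite -[ltLHS]mul1r; apply: N1; exact: leq_maxl.
  by apply: le_lt_trans (xP k) _; apply: MC; exact: leq_maxr.
have [B BP] := choice cltot.
have BB : B \in @bounded_operator R H.
  apply/bounded_operatorP; split; last by exists C => y; exact: clbnd.
  by move=> k y y'; apply: (clfun (k *: y + y')) => //; exact: cllin.
exists (Bop BB); split=> [b a Gba|y] /=; last exact: clbnd.
by apply: (clfun b) => //; exact: clG.
Qed.

End BoundedOperatorTheory.

(** * The Schur product theorem *)

Section Schur.
Local Open Scope sesquilinear_scope.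
Context {C : numClosedFieldType} {m : nat}.

Definition psd_kernel (A : 'I_m -> 'I_m -> C) : Prop :=
  forall u : 'I_m -> C, 0 <= \sum_k \sum_l u k * (u l)^*%R * A k l.

(** Diagonalising [B] in an orthonormal basis writes it as a combination, with
    nonnegative coefficients [d], of rank one kernels; pairing [A] with a rank
    one kernel is a value of the quadratic form of [A]. *)
Lemma schur_psd (A B : 'I_m -> 'I_m -> C) :
  (forall k l, B k l = (B l k)^*%R) -> psd_kernel A -> psd_kernel B ->
  0 <= \sum_k \sum_l A k l * B k l.
Proof.
move=> hB pA pB; pose M : 'M[C]_m := \matrix_(k, l) B k l.
have hM : M \is hermsymmx.
  apply/is_hermitianmxP; rewrite expr0 scale1r.
  by apply/matrixP => k l; rewrite !mxE hB.
have /orthomx_spectralP := hermitian_normalmx hM.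
have uP := spectral_unitarymx M.
set P := spectralmx M in uP *; set d := spectral_diag M => ME.
have BE k l : B k l = \sum_p (P p k)^*%R * d 0 p * P p l.
  transitivity (M k l); first by rewrite mxE.
  rewrite {1}ME invmx_unitary// mxE; apply: eq_bigr => p _.
  by rewrite mul_mx_diag !mxE.
have dE p : d 0 p = \sum_k \sum_l P p k * (P p l)^*%R * B k l.
  have : diag_mx d = P *m M *m P^t*.
    by rewrite {1}ME !mulmxA mulmxV ?unitarymx_unit// mul1mx -mulmxA
      -invmx_unitary// mulmxV ?unitarymx_unit// mulmx1.
  move=> /matrixP/(_ p p); rewrite mxE eqxx mulr1n => ->.
  rewrite mxE exchange_big; apply: eq_bigr => l _ /=.
  rewrite mxE mulr_suml; apply: eq_bigr => k _.
  by rewrite !mxE mulrAC.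
have d0 p : 0 <= d 0 p by rewrite dE; exact: pB.
have -> : \sum_k \sum_l A k l * B k l =
    \sum_p d 0 p * (\sum_k \sum_l (P p k)^*%R * ((P p l)^*%R)^*%R * A k l).
  under [RHS]eq_bigr do (rewrite mulr_sumr; under eq_bigr do rewrite mulr_sumr).
  rewrite [RHS]exchange_big; apply: eq_bigr => k _ /=.
  rewrite [RHS]exchange_big; apply: eq_bigr => l _ /=.
  rewrite BE mulr_sumr; apply: eq_bigr => p _.
  by rewrite conjCK [LHS]mulrC [d 0 p * _]mulrA [_ * d 0 p]mulrC -!mulrA.
by apply: sumr_ge0 => p _; apply: mulr_ge0 => //; exact: pA.
Qed.

End Schur.

(** * Gram kernels *)

Section InnerTheory.
Context {R : realType} {H : hilbertType R}.
Implicit Types x y : H.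

Lemma inner_conj x y : inner x y = Num.conj (inner y x).
Proof. by rewrite (hermC inner x y) expr0 mul1r. Qed.

Lemma inner_sum m (c d : 'I_m -> R[i]) (x y : 'I_m -> H) :
  inner (\sum_k c k *: x k) (\sum_l d l *: y l) =
  \sum_k \sum_l c k * Num.conj (d l) * inner (x k) (y l).
Proof.
rewrite linear_sumlz; apply: eq_bigr => k _.
rewrite linear_sumr; apply: eq_bigr => l _.
by rewrite linearZl_LR linearZr_LR /= mulrA.
Qed.

Lemma inner_rnorm x : inner x x = (rnorm x ^+ 2)%:C.
Proof. by rewrite -sqr_norm_inner -rnormE -rmorphXn. Qed.

Lemma gram_psd m (w : 'I_m -> H) :
  psd_kernel (fun k l => inner (w k) (w l)).
Proof.
by move=> u; rewrite -inner_sum inner_rnorm ler0c exprn_ge0// rnorm_ge0.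
Qed.

Lemma contraction_defect_psd (T : bop H) m (x : 'I_m -> H) :
  (forall y, rnorm (T y) <= rnorm y) ->
  psd_kernel (fun k l => inner (x k) (x l) - inner (T (x k)) (T (x l))).
Proof.
move=> T1 u.
under eq_bigr do under eq_bigr do rewrite mulrBr.
under eq_bigr do rewrite sumrB.
rewrite sumrB -!inner_sum subr_ge0.
rewrite -bop_lincomb.
by rewrite !inner_rnorm lecR lerXn2r ?nnegrE ?rnorm_ge0.
Qed.

End InnerTheory.

(** * Ampliations on a Hilbert space tensor product *)

Section Tensor.
Context {R : realType} {n : nat} {H : 'I_n -> hilbertType R}.
Variable K : hilbert_tensor H.
Implicit Types x y : forall i, H i.

Lemma rnorm_tens x : rnorm (tens K x) = \prod_(i < n) rnorm (x i).
Proof.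
have Cinj : injective (real_complex R) by move=> u v [].
have prod_ge0 : 0 <= \prod_(i < n) rnorm (x i).
  by apply: prodr_ge0 => i _; exact: rnorm_ge0.
apply/eqP; rewrite -(@eqrXn2 _ 2)// ?rnorm_ge0//; apply/eqP/Cinj.
rewrite -inner_rnorm inner_tens -prodrXl rmorph_prod.
by apply: eq_bigr => i _; rewrite inner_rnorm.
Qed.

Lemma tensB x i (u v : H i) :
  tens K (dfwith x (u - v)) = tens K (dfwith x u) - tens K (dfwith x v).
Proof.
have := tens_linear K x (-1) v u; rewrite !scaleN1r ![- _ + _]addrC.
exact.
Qed.

Lemma tensZ x i a (u : H i) :
  tens K (dfwith x (a *: u)) = a *: tens K (dfwith x u).
Proof.
have /= T0 := tensB x _ u u; rewrite !subrr in T0.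
by have := tens_linear K x a u 0; rewrite T0 !addr0.
Qed.

Lemma dfwith_id x i : dfwith x (x i) = x.
Proof. by apply: functional_extensionality_dep => j; case: dfwithP. Qed.

(** A unit vector [e] in the i-th slot turns the product of the other factors
    into a Gram kernel of vectors of [K] itself, so that no tensor product over
    the remaining indices has to be considered. *)
Lemma inner_tens_factor i (e : H i) x y (u v : H i) : inner e e = 1 ->
  inner (tens K (dfwith x u)) (tens K (dfwith y v)) =
  inner (tens K (dfwith x e)) (tens K (dfwith y e)) * inner u v.
Proof.
move=> e1; rewrite !inner_tens (bigD1 i)//= [in RHS](bigD1 i)//= !dfwith_in.
rewrite e1 mul1r mulrC; congr (_ * _); apply: eq_bigr => j ji.
by rewrite !dfwith_out// eq_sym.
Qed.

(** The difference of the two squared norms is the sum of the entrywise product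
    of the Gram kernel of the vectors [w k] with the defect kernel of [T]. *)
Lemma rnorm_ampliation_le i (T : bop (H i)) (e : H i) :
  (forall u, rnorm (T u) <= rnorm u) -> inner e e = 1 ->
  forall m (c : 'I_m -> R[i]) (x : 'I_m -> forall j, H j),
  rnorm (\sum_k c k *: tens K (dfwith (x k) (T (x k i)))) <=
  rnorm (\sum_k c k *: tens K (x k)).
Proof.
move=> T1 e1 m c x.
rewrite -ler_sqr ?nnegrE ?rnorm_ge0// -lecR -!inner_rnorm -subr_ge0.
pose w k := c k *: tens K (dfwith (x k) e).
have innerE (u : 'I_m -> H i) :
    inner (\sum_k c k *: tens K (dfwith (x k) (u k)))
          (\sum_k c k *: tens K (dfwith (x k) (u k))) =
    \sum_k \sum_l inner (w k) (w l) * inner (u k) (u l).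
  rewrite inner_sum; apply: eq_bigr => k _; apply: eq_bigr => l _.
  by rewrite (inner_tens_factor _ e)// linearZl_LR linearZr_LR /= !mulrA.
have -> : \sum_k c k *: tens K (x k) =
    \sum_k c k *: tens K (dfwith (x k) (x k i)).
  by apply: eq_bigr => k _; rewrite dfwith_id.
rewrite !innerE -sumrB.
under eq_bigr do (rewrite -sumrB; under eq_bigr do rewrite -mulrBr).
apply: schur_psd; [|exact: gram_psd|exact: contraction_defect_psd].
by move=> k l; rewrite rmorphB; congr (_ - _); exact: inner_conj.
Qed.

(** [ampliation] is a chosen operator, so its defining property holds only once
    some operator is known to have it; the choice is then harmless, as operators
    that agree on elementary tensors are equal. *)
Lemma ampliationP i (T : bop (H i)) (e : H i) :
  (forall u, rnorm (T u) <= rnorm u) -> inner e e = 1 ->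
  (forall x, ampliation K T (tens K x) = tens K (dfwith x (T (x i)))) /\
  (forall v, rnorm (ampliation K T v) <= rnorm v).
Proof.
move=> T1 e1.
have argE x : (fun j => dfwith (fun j => bop_id (H j)) T j (x j)) =
    dfwith x (T (x i)).
  apply: functional_extensionality_dep => j.
  by case: dfwithP => [|j' ij']; rewrite ?dfwith_in ?dfwith_out.
pose G (b a : K) := exists m (c : 'I_m -> R[i]) (x : 'I_m -> forall j, H j),
  b = \sum_k c k *: tens K (x k) /\
  a = \sum_k c k *: tens K (dfwith (x k) (T (x k i))).
have [|b a [m [c [x [-> ->]]]]|v d d0|B [BG B1]] :=
    @bounded_relation_extends R K G 1 ler01.
- move=> k b a b' a' [m [c [x [-> ->]]]] [m' [c' [x' [-> ->]]]].
  pose c2 (p : 'I_(m + m')) :=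
    match fintype.split p with inl q => k * c q | inr q => c' q end.
  pose x2 (p : 'I_(m + m')) :=
    match fintype.split p with inl q => x q | inr q => x' q end.
  have sE (F : (forall j, H j) -> K) :
      k *: (\sum_p c p *: F (x p)) + \sum_p c' p *: F (x' p) =
      \sum_p c2 p *: F (x2 p).
    rewrite big_split_ord scaler_sumr; congr (_ + _); apply: eq_bigr => p _.
      by rewrite /c2 /x2 -/(unsplit (inl p)) unsplitK scalerA.
    by rewrite /c2 /x2 -/(unsplit (inr p)) unsplitK.
  exists (m + m')%N, c2, x2; split; first exact: sE.
  exact: (sE (fun z => tens K (dfwith z (T (z i))))).
- by rewrite mul1r; apply: (rnorm_ampliation_le _ _ e).
- have [w [m [c [x wE]]] wv] := dense_rnorm _ v _ (@tens_dense _ _ _ K) d0.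
  exists w, (\sum_k c k *: tens K (dfwith (x k) (T (x k i)))).
  by split => //; exists m, c, x.
have BT x : B (tens K x) = tens K (dfwith x (T (x i))).
  by apply: BG; exists 1%N, (fun=> 1), (fun=> x); rewrite !big_ord1 !scale1r.
have AT x : ampliation K T (tens K x) = tens K (dfwith x (T (x i))).
  rewrite -argE; move: x; rewrite /ampliation /tensor_op.
  by case: xgetP => [A _ //|/(_ B)[] x]; rewrite BT argE.
split=> // v; suff -> : ampliation K T v = B v by rewrite -[leRHS]mul1r.
apply: (bop_eq_dense _ _ [set v | exists m (c : 'I_m -> R[i])
    (x : 'I_m -> forall i, H i), v = \sum_(k < m) c k *: tens K (x k)]).
  by move=> w d; exact: (dense_rnorm _ w _ (@tens_dense _ _ _ K)).
move=> _ [m [c [x ->]]]; rewrite !bop_lincomb; apply: eq_bigr => k _.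
by rewrite AT BT.
Qed.

End Tensor.

(** * Approximate eigenvectors on the unit circle *)

Section ApproximateEigenvectors.
Context {R : realType} {H : hilbertType R}.

(** The range of 1 - U contains y - U^k y for every k, hence y - A_N y for the
    ergodic averages A_N; the telescoping sum
    (1 - U) A_N y = (y - U^N y) / N and the lower bound [c] force A_N y to tend
    to 0. *)
Lemma ergodic_dense_range (U : bop H) (c : R) :
  (forall x, rnorm (U x) <= rnorm x) -> 0 < c ->
  (forall x, c * rnorm x <= rnorm (x - U x)) ->
  forall y (e : R), 0 < e -> exists b, rnorm (b - U b - y) < e.
Proof.
move=> U1 c0 Uc y e e0.
(* s k is the sum of the first k iterates, so (1 - U) s_k = y - U^k y *)
pose u k := iter k U y; pose s k := iter k (fun v => y + U v) 0.
have usE k : s k - U (s k) = y - u k.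
  elim: k => [|k IH]; first by rewrite /s /u /= linear0 !subrr.
  rewrite /s /u !iterS -/(s k) -/(u k) linearD opprD addrACA -(linearB U).
  by rewrite IH linearB -addrA addKr.
have u1 k : rnorm (u k) <= rnorm y.
  by elim: k => [|k IH] //; apply: le_trans (U1 _) IH.
have [N _ /(_ N (leqnn N)) /= Ne] := harmonic_lt (2 * rnorm y / c) _ e0.
pose avg (v : nat -> H) := (N.+1%:R^-1)%:C *: \sum_(k < N.+1) v k.
have avgU v : U (avg v) = avg (U \o v).
  rewrite /avg linearZ /=; congr (_ *: _).
  exact: (raddf_sum U).
have avgB v w : avg v - avg w = avg (v - w).
  by rewrite /avg -scalerBr -sumrB.
have avg_tele : avg u - U (avg u) = (N.+1%:R^-1)%:C *: (y - u N.+1).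
  rewrite avgU avgB /avg -[y - _]opprB.
  rewrite -(telescope_sumr u (leq0n N.+1)) big_mkord.
  by rewrite -sumrN; congr (_ *: _); apply: eq_bigr => k _; rewrite opprB.
exists (avg s).
have -> : avg s - U (avg s) = y - avg u.
  have yE : y = avg (fun=> y).
    rewrite /avg sumr_const card_ord -(@scaler_nat R[i]) scalerA.
    rewrite -(rmorph_nat (real_complex R)) -rmorphM /= mulVf ?scale1r//.
    by rewrite pnatr_eq0.
  by rewrite {1}yE avgU !avgB; congr avg; apply/funext => k; exact: usE.
rewrite addrAC subrr add0r rnormN; apply: le_lt_trans Ne.
rewrite mulrAC ler_pdivlMr// mulrC (le_trans (Uc _))// avg_tele rnormZ.
rewrite re_norm_real ger0_norm ?invr_ge0// mulrC ler_wpM2r ?invr_ge0//.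
by rewrite (le_trans (ler_rnormB _ _))// mulr_natl mulr2n lerD2l.
Qed.

Lemma bounded_below_invertible (S : bop H) (c : R) : 0 < c ->
  (forall x, c * rnorm x <= rnorm (S x)) ->
  (forall y (e : R), 0 < e -> exists x, rnorm (S x - y) < e) ->
  bop_invertible S.
Proof.
move=> c0 Sc Sd.
have [|k b a b' a' -> ->|b a ->|y e e0|B [BS Bc]] :=
    @bounded_relation_extends R H (fun b a => b = S a) c^-1.
- by rewrite invr_ge0 ltW.
- by rewrite linearP.
- by rewrite mulrC ler_pdivlMr// mulrC.
- by have [x Sx] := Sd y e e0; exists (S x), x.
exists B; split=> [x|y]; first exact: BS.
have SB : S \o B \in @bounded_operator R H.
  apply/bounded_operatorP; split=> [k x x'|]; first by rewrite /= !linearP.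
  have [M M0 SM] := bop_bounded S; have [N N0 BN] := bop_bounded B.
  exists (M * N) => x /=; rewrite (le_trans (SM _))// -mulrA.
  by rewrite ler_wpM2l.
apply: (bop_eq_dense (Bop SB) (bop_id H) (range S)).
  by move=> v e /(Sd v)[x Sx]; exists (S x) => //; exists x.
by move=> _ [x _ <-] /=; rewrite (BS _ x).
Qed.

(** If no such [x] existed, T - z would be bounded below, and so would 1 - U for
    the contraction U = T / z; its range would then be dense, which makes T - z
    invertible. *)
Lemma approximate_eigenvector (T : bop H) (z : R[i]) :
  (forall x, rnorm (T x) <= rnorm x) -> `|z| = 1 -> spectrum T z ->
  forall e : R, 0 < e -> exists x, rnorm x = 1 /\ rnorm (T x - z *: x) <= e.
Proof.
move=> T1 z1 Tz e e0; apply: contrapT => no; apply: Tz.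
have z0 : z != 0 by rewrite -normr_eq0 z1 oner_eq0.
have zV1 : complex.Re `|z^-1| = 1 by rewrite normfV z1 invr1.
have SE x : (T - z *: bop_id H) x = T x - z *: x by [].
have UE x : (z^-1 *: T) x = z^-1 *: T x by [].
have Tc x : e * rnorm x <= rnorm (T x - z *: x).
  have [->|x0] := eqVneq (rnorm x) 0; first by rewrite mulr0 rnorm_ge0.
  have xgt0 : 0 < rnorm x by rewrite lt_def x0 rnorm_ge0.
  rewrite leNgt; apply/negP => small; apply: no.
  have xV : complex.Re `|((rnorm x)^-1)%:C| = (rnorm x)^-1.
    by rewrite re_norm_real ger0_norm// invr_ge0 ltW.
  exists (((rnorm x)^-1)%:C *: x); split; first by rewrite rnormZ xV mulVf.
  rewrite (linearZ_LR T) /= scalerA mulrC -scalerA -scalerBr rnormZ xV mulrC.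
  by rewrite ler_pdivrMr// ltW.
have UT x : rnorm (x - z^-1 *: T x) = rnorm (T x - z *: x).
  rewrite -[RHS]mul1r -zV1 -rnormZ scalerBr scalerA mulVf// scale1r.
  by rewrite rnormB.
apply: (bounded_below_invertible _ e) => // y d d0.
have [||b byd] := ergodic_dense_range (z^-1 *: T) e _ e0 _ y d d0.
- by move=> x; rewrite UE rnormZ zV1 mul1r.
- by move=> x; rewrite UE UT.
exists (- z^-1 *: b); rewrite SE (linearZ_LR T) /= scalerA mulrN mulfV//.
by rewrite scaleN1r opprK scaleNr [- _ + b]addrC.
Qed.

End ApproximateEigenvectors.

(** * The isometry *)

Lemma phase (R : realType) (a : R[i]) :
  exists z : R[i], `|z| = 1 /\ a * z = `|a|.
Proof.
have [->|a0] := eqVneq a 0; first by exists 1; rewrite normr1 mul0r normr0.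
exists (`|a| / a); split; last by rewrite mulrC divfK.
by rewrite normf_div normr_id divff ?normr_eq0.
Qed.

(** The phases [z i] align the terms of the sum: on the tensor product of
    approximate eigenvectors for the [z i], the i-th term acts almost as the
    scalar c_i z_i = |c_i|, so nothing cancels. *)
Lemma opnorm_sum_ampliation (R : realType) (n : nat)
    (H : 'I_n -> hilbertType R) (K : hilbert_tensor H)
    (T : forall i : 'I_n, bop (H i)) (c : 'I_n -> R[i]) :
  (forall i u, rnorm (T i u) <= rnorm u) ->
  (forall i, [set z : R[i] | `|z| = 1] `<=` spectrum (T i)) ->
  opnorm (\sum_(i < n) c i *: ampliation K (T i)) =
  \sum_(i < n) complex.Re `|c i|.
Proof.
move=> T1 Tsp; set L := \sum_(i < n) complex.Re `|c i|.
have aeig i z e : `|z| = 1 -> 0 < e ->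
    exists x, rnorm x = 1 /\ rnorm (T i x - z *: x) <= e.
  by move=> z1 e0; apply: approximate_eigenvector => //; exact: Tsp.
have L0 : 0 <= L by apply: sumr_ge0 => i _; exact: re_normc_ge0.
(* the spectrum is nonempty, so H i contains a unit vector *)
have amp i :
    (forall x, ampliation K (T i) (tens K x) =
      tens K (dfwith x (T i (x i)))) /\
    (forall v, rnorm (ampliation K (T i) v) <= rnorm v).
  have [e [e1 _]] := aeig i 1 1 (normr1 _) ltr01.
  by apply: (ampliationP K i (T i) e) => //; rewrite inner_rnorm e1 expr1n.
have SE v : (\sum_(i < n) c i *: ampliation K (T i)) v =
    \sum_(i < n) c i *: ampliation K (T i) v by rewrite bop_sumE.
apply/le_anti/andP; split.
  apply: opnorm_le => // v; rewrite SE (le_trans (rnorm_sum _ _ _))// mulr_suml.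
  apply: ler_sum => i _; rewrite rnormZ ler_wpM2l ?re_normc_ge0//.
  exact: (amp i).2.
apply/ler_addgt0Pr => d d0.
have L1 : 0 < L + 1 by rewrite ltr_wpDl.
(* the accuracy e is chosen so that L * e <= d *)
pose e := d / (L + 1); have e0 : 0 < e by rewrite divr_gt0.
have [z zP] := choice (fun i => phase _ (c i)).
pose w i := projT1 (cid (aeig i (z i) e (zP i).1 e0)).
have wP i : rnorm (w i) = 1 /\ rnorm (T i (w i) - z i *: w i) <= e.
  by rewrite /w; case: cid.
have w1 : rnorm (tens K w) = 1.
  by rewrite rnorm_tens big1// => i _; have [] := wP i.
have close i : rnorm (ampliation K (T i) (tens K w) - z i *: tens K w) <= e.
  rewrite (amp i).1 -[in X in _ - X](dfwith_id w i) -tensZ -tensB rnorm_tens.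
  rewrite (bigD1 i)//= dfwith_in big1 ?mulr1; last first.
    by move=> j ji; rewrite dfwith_out 1?eq_sym//; have [] := wP j.
  by have [] := wP i.
have -> : L = rnorm (\sum_(i < n) (c i * z i) *: tens K w).
  rewrite -scaler_suml (eq_bigr (fun i => (complex.Re `|c i|)%:C)).
    by rewrite -rmorph_sum -/L rnormZ w1 mulr1 re_norm_real ger0_norm.
  by move=> i _; rewrite (zP i).2 RRe_real ?normr_real.
have := le_opnorm (\sum_(i < n) c i *: ampliation K (T i)) (tens K w).
rewrite w1 mulr1 SE => hi.
set v := \sum_(i < n) _ *: _ in hi; set v' := \sum_(i < n) _ *: _.
rewrite -[v']subr0 (le_trans (rnorm_dist v _ _))// subr0 addrC lerD//.
rewrite rnormB /v /v' -sumrB (le_trans (rnorm_sum _ _ _))//.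
apply: (@le_trans _ _ (L * e)).
  rewrite mulr_suml; apply: ler_sum => i _.
  by rewrite -scalerA -scalerBr rnormZ ler_wpM2l ?re_normc_ge0.
by rewrite /e mulrA ler_pdivrMr// mulrC ler_wpM2l ?lerDl// ltW.
Qed.

Theorem theorem3p1 (R : realType) (n : nat) (n_ge1 : (1 <= n)%N)
    (H : 'I_n -> hilbertType R) (K : hilbert_tensor H)
    (T : forall i : 'I_n, bop (H i))
    (T_contraction : forall i, bop_contraction (T i))
    (T_spectrum : forall i, [set z : R[i] | `|z| = 1] `<=` spectrum (T i)) :
  l1_isometry (fun a : 'rV[R[i]]_n => \sum_(i < n) a 0 i *: ampliation K (T i)).
Proof.
move=> a b.
have T1 i u : rnorm (T i u) <= rnorm u.
  rewrite (le_trans (le_opnorm _ _))// ler_piMl ?rnorm_ge0//.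
  exact: T_contraction.
rewrite /l1norm -(opnorm_sum_ampliation _ _ _ K T (fun i => (a - b) 0 i))//.
by rewrite -sumrB; congr opnorm; apply: eq_bigr => i _; rewrite -scalerBl !mxE.
Qed.
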